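(* Let $A\subset\mathbb{R}^p$ be a $d$-regular set, and let $f$ be a $d$-Riesz-like function on $(0,\infty)$. If for a measure $\mu$ on $A$ and a constant $M$ we have $$U_f^\mu(y)\geqslant M,\quad y\in A\setminus E,$$ where $E\subset A$ is $f$-negligible, then $U_f^\mu(y)\geqslant M$ for every $y\in A$.
   Context: All measures are positive Borel measures supported on $A$. $d$-regular: a compact set $A\subset\mathbb{R}^p$ is called $d$-regular, $0<d\leqslant p$, if there exist two positive constants $c$ and $C$ such that for any point $y\in A$ and any $r$ with $0<r<\operatorname{diam}(A)$ we have $cr^d\leqslant\mathcal{H}_d(B(y,r)\cap A)\leqslant Cr^d$. Here $\mathcal{H}_d$ is the $d$-dimensional Hausdorff measure on $\mathbb{R}^p$ normalized by $\mathcal{H}_d([0,1]^d)=1$, and $B(y,r)$ is the open ball in $\mathbb{R}^p$ with center $y$ and radius $r$. $d$-Riesz-like: a function $f\colon(0,\infty)\to(0,\infty)$ is called $d$-Riesz-like if it is continuous, strictly decreasing, and for some $\varepsilon$ with $0<\varepsilon<d$ and some $t_\varepsilon>0$ the function $t\mapsto t^{d-\varepsilon}f(t)$ is increasing on $[0,t_\varepsilon]$, where its value at zero is formally defined by $\lim_{t\to0^+}t^{d-\varepsilon}f(t)$. One formally sets $f(0):=\lim_{t\to0^+}f(t)\in(0,\infty]$. Potential: for a measure $\mu$ on $A$, $U_f^\mu(y):=\int_A f(|x-y|)\,\mathrm{d}\mu(x)$ for $y\in\mathbb{R}^p$. $f$-negligible: a set $E\subset A$ is called $f$-negligible if for any compact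 set $E_1\subset E$ and any measure $\mu$ such that $U_f^\mu$ is bounded on $E_1$, we have $\mu(E_1)=0$.
   Formalization: The set A is additionally assumed not to be a single point: a singleton is vacuously d-regular, and the claim then fails for A = E = {a}, f(0) = ∞, μ = 0, M = 1. *)

(* Defs.v *)
From HB Require Import structures.
From mathcomp Require Import all_boot all_order all_algebra.
From mathcomp Require Import all_classical all_reals all_analysis.

Set Implicit Arguments.
Unset Strict Implicit.
Unset Printing Implicit Defensive.

Import Order.TTheory GRing.Theory Num.Theory.
Import numFieldNormedType.Exports.

Local Open Scope classical_set_scope.
Local Open Scope ring_scope.

(* The library's norm on ['rV[R]_p] is the sup norm, hence the definitions of
   the Euclidean norm, balls and diameter below. The topology of ['rV[R]_p] is
   the product topology, i.e. the Euclidean one. *)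
Definition enorm (R : realType) (p : nat) (x : 'rV[R]_p) : R :=
  Num.sqrt (\sum_(i < p) x 0 i ^+ 2).

Definition eball (R : realType) (p : nat) (y : 'rV[R]_p) (r : R) :
    set 'rV[R]_p :=
  [set x | enorm (x - y) < r].

(* The point 0 is included in the supremum so that the diameter of the empty
   set is 0 and not -oo. *)
Definition ediam (R : realType) (p : nat) (S : set 'rV[R]_p) : \bar R :=
  ereal_sup (0%E |` [set (enorm (z.1 - z.2))%:E | z in S `*` S]).

Definition delta_cover (R : realType) (p : nat) (delta : R)
    (S : set 'rV[R]_p) : set (nat -> set 'rV[R]_p) :=
  [set U | S `<=` \bigcup_k U k /\ forall k, (ediam (U k) <= delta%:E)%E].

Definition unnormalized_hausdorff (R : realType) (p : nat) (d : R)
    (S : set 'rV[R]_p) : \bar R :=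
  ereal_sup [set ereal_inf
      [set (\sum_(0 <= k <oo) poweR (ediam (U k)) d)%E | U in delta_cover delta S]
    | delta in [set delta : R | 0 < delta]].

(* [0, 1]^n embedded in R^p along the first n coordinates, for n <= p *)
Definition unit_cube (R : realType) (p n : nat) : set 'rV[R]_p :=
  [set x | forall i : 'I_p, if (i < n)%N then 0 <= x 0 i <= 1 else x 0 i == 0].

(* H_d with the normalization H_d([0, 1]^d) = 1. The cube only makes sense for
   an integer d; for other d no normalization is applied. *)
Definition hausdorff (R : realType) (p : nat) (d : R) (S : set 'rV[R]_p) :
    \bar R :=
  let c := if d \is a Num.nat
           then (fine (unnormalized_hausdorff d
                         (unit_cube (Num.truncn d) : set 'rV[R]_p)))^-1
           else 1 in
  (c%:E * unnormalized_hausdorff d S)%E.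

Definition d_regular (R : realType) (p : nat) (d : R) (A : set 'rV[R]_p) :
    Prop :=
  [/\ compact A, 0 < d <= p%:R &
      exists c C : R, [/\ 0 < c, 0 < C &
        forall (y : 'rV[R]_p) (r : R), A y -> 0 < r -> (r%:E < ediam A)%E ->
          ((c * r `^ d)%:E <= hausdorff d (eball y r `&` A)
                           <= (C * r `^ d)%:E)%E]].

(* Extension to [0, +oo[ of a function on ]0, +oo[ by its right limit at 0,
   possibly infinite. *)
Definition extend0 (R : realType) (g : R -> R) (t : R) : \bar R :=
  if t == 0 then lim ((g s)%:E @[s --> 0^'+]) else (g t)%:E.

(* Functions on ]0, +oo[ are represented by functions on R whose values outside
   of ]0, +oo[ are irrelevant. *)
Definition riesz_like (R : realType) (d : R) (f : R -> R) : Prop :=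
  [/\ {in `]0, +oo[, forall t, 0 < f t},
      {in `]0, +oo[, continuous f},
      {in `]0, +oo[ &, {homo f : s t / s < t >-> t < s}} &
      exists eps teps : R, [/\ 0 < eps < d, 0 < teps &
        {in `[0, teps] &,
          {homo extend0 (fun t => t `^ (d - eps) * f t) :
             s t / s <= t >-> (s <= t)%E}}]].

(* R^p with its Borel sigma-algebra *)
Definition borelType (R : realType) (p : nat) :=
  g_sigma_algebraType (@open 'rV[R]_p).

(* A is always closed here, so that the support of mu is contained in A exactly
   when the complement of A is mu-null. *)
Definition measure_on (R : realType) (p : nat) (A : set 'rV[R]_p)
    (mu : {measure set (borelType R p) -> \bar R}) : Prop :=
  mu (~` A) = 0%E.

Definition potential (R : realType) (p : nat) (A : set 'rV[R]_p) (f : R -> R)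
    (mu : {measure set (borelType R p) -> \bar R}) (y : 'rV[R]_p) : \bar R :=
  (\int[mu]_(x in A) extend0 f (enorm ((x : 'rV[R]_p) - y)))%E.

Definition f_negligible (R : realType) (p : nat) (A : set 'rV[R]_p)
    (f : R -> R) (E : set 'rV[R]_p) : Prop :=
  E `<=` A /\
  forall (E1 : set 'rV[R]_p) (mu : {measure set (borelType R p) -> \bar R}),
    compact E1 -> E1 `<=` E -> measure_on A mu ->
    (exists K : R, forall y, E1 y -> (potential A f mu y <= K%:E)%E) ->
    mu E1 = 0%E.

(* Main.v *)
Require Import Defs.
From HB Require Import structures.
From mathcomp Require Import all_boot all_order all_algebra.
From mathcomp Require Import all_classical all_reals all_analysis.
From mathcomp Require Import measurable_realfun.
From mathcomp Require Import ring lra.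

Set Implicit Arguments.
Unset Strict Implicit.
Unset Printing Implicit Defensive.

Import Order.TTheory GRing.Theory Num.Theory.
Import numFieldNormedType.Exports.

Local Open Scope classical_set_scope.
Local Open Scope ring_scope.

(** Let [U] be the potential of [mu] and let [sigma] be the [d]-dimensional
    Hausdorff measure on [A] near a point [y0] of [A]. The inequality at [y0]
    comes from averaging [U] with respect to [sigma] over small balls [B_r]
    centered at [y0], for which two facts are needed.

    The averages see only the points where [U >= M]. By lower semicontinuity
    ([closed_potential_le]) the set of points of [A] where [U < M] is a countable
    union of compact sets, all contained in the exceptional set. Upper regularity
    of [sigma] and the integrability of the kernel against it, which
    [ball_potential_le] obtains by cutting a ball into dyadic shells, show that
    [sigma] has a bounded potential on [A]. Since the exceptional set is
    negligible, [sigma] vanishes on each of these compact sets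
    ([ae_potential_ge]).

    The averages converge to [U y0]. By Tonelli's theorem the average of [U] is
    the integral in [x] against [mu] of the average over [y] in [B_r] of
    [f |x - y|]. The latter tends to [f |x - y0|], and it is at most a constant
    multiple of [f |x - y0|] plus a constant: far from [y0] because halving a
    small distance multiplies [f] by a bounded factor, and at distance less than
    [2 r] because [B_r] lies in the ball of radius [3 r] around [x], where
    [ball_potential_le] applies, while lower regularity bounds the mass of [B_r]
    from below. Dominated convergence concludes ([potential_ge_of_ae]) when [U y0]
    and [mu] are finite; a measure of infinite mass on the bounded set [A] has
    infinite potential everywhere on [A].

    This requires [sigma] to be a measure on the Borel sets. Hausdorff measure is
    an outer measure that is additive on sets at positive distance, so that open
    sets are measurable by Caratheodory's criterion ([open_caratheodory]). *)

(** * The Euclidean norm *)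

Section EuclideanNorm.
Variables (R : realType) (p : nat).
Implicit Types (x y z : 'rV[R]_p).

Lemma enorm_ge0 x : 0 <= enorm x.
Proof. exact: sqrtr_ge0. Qed.

Lemma sqr_enorm x : enorm x ^+ 2 = \sum_(i < p) x 0 i ^+ 2.
Proof. by rewrite sqr_sqrtr// sumr_ge0// => i _; exact: sqr_ge0. Qed.

Lemma enorm0 : enorm (0 : 'rV[R]_p) = 0.
Proof.
by rewrite /enorm big1 ?sqrtr0// => i _; rewrite mxE expr0n.
Qed.

Lemma enormN x : enorm (- x) = enorm x.
Proof. by congr Num.sqrt; apply: eq_bigr => i _; rewrite mxE sqrrN. Qed.

Lemma enormBC x y : enorm (x - y) = enorm (y - x).
Proof. by rewrite -enormN opprB. Qed.

Lemma enorm_coord x i : `|x 0 i| <= enorm x.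
Proof.
rewrite -(ler_pXn2r (n := 2)) ?nnegrE ?enorm_ge0// sqr_enorm real_normK ?num_real//.
by rewrite (bigD1 i)//= lerDl sumr_ge0// => j _; exact: sqr_ge0.
Qed.

Lemma enorm_eq0 x : enorm x = 0 -> x = 0.
Proof.
move=> x0; apply/rowP => i; rewrite mxE; apply/eqP.
by rewrite -normr_eq0 eq_le normr_ge0 andbT -x0 enorm_coord.
Qed.

Lemma cauchy_schwarz x y : \sum_(i < p) x 0 i * y 0 i <= enorm x * enorm y.
Proof.
have [/eqP x0|x0] := boolP (enorm x == 0).
  rewrite (enorm_eq0 x0) enorm0 mul0r big1// => i _.
  by rewrite mxE mul0r.
have [/eqP y0|y0] := boolP (enorm y == 0).
  rewrite (enorm_eq0 y0) enorm0 mulr0 big1// => i _.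
  by rewrite mxE mulr0.
set a := enorm x; set b := enorm y; set s := \sum_i _.
have a0 : 0 < a by rewrite lt_neqAle eq_sym x0 enorm_ge0.
have b0 : 0 < b by rewrite lt_neqAle eq_sym y0 enorm_ge0.
have : 0 <= \sum_(i < p) (b * x 0 i - a * y 0 i) ^+ 2.
  by apply: sumr_ge0 => i _; exact: sqr_ge0.
have -> : \sum_(i < p) (b * x 0 i - a * y 0 i) ^+ 2 = (a * b) * (a * b - s) *+ 2.
  transitivity (b ^+ 2 * (\sum_(i < p) x 0 i ^+ 2)
      + a ^+ 2 * (\sum_(i < p) y 0 i ^+ 2) - (a * b * s) *+ 2).
    rewrite /s !mulr_sumr -sumrMnl -sumrN -!big_split/=.
    by apply: eq_bigr => i _; ring.
  by rewrite -!sqr_enorm -/a -/b; ring.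
by rewrite pmulrn_lge0// pmulr_rge0 ?mulr_gt0// subr_ge0.
Qed.

Lemma enormD x y : enorm (x + y) <= enorm x + enorm y.
Proof.
rewrite -(ler_pXn2r (n := 2)) ?nnegrE ?addr_ge0 ?enorm_ge0//.
rewrite sqrrD !sqr_enorm.
have -> : \sum_(i < p) (x + y) 0 i ^+ 2 = \sum_(i < p) x 0 i ^+ 2
    + (\sum_(i < p) x 0 i * y 0 i) *+ 2 + \sum_(i < p) y 0 i ^+ 2.
  rewrite -sumrMnl -!big_split/=; apply: eq_bigr => i _.
  by rewrite mxE sqrrD.
by rewrite lerD2r lerD2l lerMn2r cauchy_schwarz orbT.
Qed.

Lemma enorm_triangle y x z : enorm (x - z) <= enorm (x - y) + enorm (y - z).
Proof. by have := enormD (x - y) (y - z); rewrite addrA subrK. Qed.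

Lemma enorm_le_sup x (e : R) : 0 <= e -> (forall i, `|x 0 i| <= e) ->
  enorm x <= p.+1%:R * e.
Proof.
move=> e0 xe; rewrite -(ler_pXn2r (n := 2)) ?nnegrE ?mulr_ge0 ?enorm_ge0//.
rewrite sqr_enorm (@le_trans _ _ (\sum_(i < p) e ^+ 2))//.
  apply: ler_sum => i _; rewrite -real_normK ?num_real//.
  by rewrite ler_pXn2r// nnegrE.
rewrite big_const_ord iter_addr_0 exprMn -[leLHS]mulr_natl ler_wpM2r ?sqr_ge0//.
by rewrite -natrX ler_nat (leq_trans (leqnSn p))// expnS leq_pmulr// expn_gt0.
Qed.

Lemma open_eball y r : open (eball y r).
Proof.
rewrite openE => x yxr; apply/nbhs_ballP.
pose e := (r - enorm (x - y)) / p.+2%:R.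
have e0 : 0 < e by rewrite divr_gt0// subr_gt0.
exists e => //= z [_ xz]; rewrite /eball/=.
rewrite (le_lt_trans (enorm_triangle x z y))// -ltrBrDr.
have /le_lt_trans : enorm (z - x) <= p.+1%:R * e.
  apply: enorm_le_sup => [|i]; first exact: ltW.
  by have := ltW (xz 0 i); rewrite /ball/= !mxE distrC.
apply; rewrite /e mulrCA gtr_pMr ?subr_gt0//.
by rewrite ltr_pdivrMr// mul1r ltr_nat.
Qed.

Lemma open_sub_eball (O : set 'rV[R]_p) x : open O -> O x ->
  exists2 r : R, 0 < r & eball x r `<=` O.
Proof.
move=> oO Ox; have /nbhs_ballP[r /= r0 xrO] := open_nbhs_nbhs (conj oO Ox).
exists r => // y xry; apply: xrO; split => // i j.
rewrite (ord1 i) /ball/=; apply: le_lt_trans xry.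
by have := enorm_coord (y - x) j; rewrite !mxE distrC.
Qed.

Lemma closure_eball (K : set 'rV[R]_p) y r : closure K y -> 0 < r ->
  exists2 x, K x & enorm (x - y) < r.
Proof.
move=> Ky r0; have [|x [Kx yrx]] := Ky (eball y r).
  apply: open_nbhs_nbhs; split; first exact: open_eball.
  by rewrite /eball/= subrr enorm0.
by exists x.
Qed.

Lemma measurable_open (O : set 'rV[R]_p) : open O ->
  measurable (O : set (borelType R p)).
Proof. exact: sub_sigma_algebra. Qed.

Lemma measurable_eball y r : measurable (eball y r : set (borelType R p)).
Proof. by apply: measurable_open; exact: open_eball. Qed.

Lemma measurable_closed (K : set 'rV[R]_p) : closed K ->
  measurable (K : set (borelType R p)).
Proof.
move=> cK; rewrite -(setCK K); apply: measurableC; apply: measurable_open.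
exact: closed_openC.
Qed.

Lemma rV_hausdorff : hausdorff_space 'rV[R]_p.
Proof. exact: norm_hausdorff. Qed.

Lemma compact_measurable_rV (K : set 'rV[R]_p) : compact K ->
  measurable (K : set (borelType R p)).
Proof.
by move=> cK; apply: measurable_closed; apply: compact_closed => //; exact: rV_hausdorff.
Qed.

Lemma measurable_coord i :
  measurable_fun setT (fun x : borelType R p => (x : 'rV[R]_p) 0 i).
Proof.
apply: (measurability _ (RGenOpens.measurableE R)) => //.
move=> _ [_ [a [b ->] <-]]; rewrite setTI; apply: measurable_open.
apply: (@open_comp _ _ (fun x : 'rV[R]_p => x 0 i) `]a, b[%classic).
  by move=> x _; exact: coord_continuous.
exact: interval_open.
Qed.

Lemma measurable_enormB : measurable_fun setT
  (fun z : borelType R p * borelType R p => enorm ((z.1 : 'rV[R]_p) - z.2)).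
Proof.
have ms : measurable_fun setT (@Num.sqrt R).
  by apply: continuous_measurable_fun; exact: sqrt_continuous.
apply: (measurableT_comp ms); apply: measurable_sum => i.
apply: measurable_funX; under eq_fun do rewrite !mxE.
apply: measurable_funB.
  exact: (measurableT_comp (measurable_coord i) (@measurable_fst _ _ _ _)).
exact: (measurableT_comp (measurable_coord i) (@measurable_snd _ _ _ _)).
Qed.

End EuclideanNorm.
(** * Hausdorff measure as a Borel measure *)

Section CaratheodoryCriterion.
Variables (R : realType) (p : nat).
Variable mu : {outer_measure set 'rV[R]_p -> \bar R}.
Hypothesis metric : forall (e : R) (S T : set 'rV[R]_p), 0 < e ->
  (forall s t, S s -> T t -> e <= enorm (s - t)) ->
  (mu S + mu T <= mu (S `|` T))%E.

(** Exhaust [O] by the sets [P k] of points at distance at least [1 / (k + 1)]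
    from its complement; these are separated from the complement, so only
    [mu (X `&` O) <= sup_k mu (X `&` P k)] is at stake. The ring between [P k] and
    [P (k + 1)] is separated from [P (k - 1)], hence its mass is at most
    [mu (P (k + 1)) - mu (P (k - 1))] within [X], and the sum of these bounds
    telescopes. *)
Lemma open_caratheodory (O : set 'rV[R]_p) : open O -> mu.-caratheodory O.
Proof.
move=> oO; apply: le_caratheodory_measurable => X.
have [Xoo|Xfin] := eqVneq (mu X) +oo%E; first by rewrite Xoo leey.
have fin A : A `<=` X -> mu A \is a fin_num.
  move=> AX; rewrite ge0_fin_numE ?outer_measure_ge0//.
  by rewrite (le_lt_trans (le_outer_measure mu _ _ AX))// ltey.
have finI A : mu (X `&` A) \is a fin_num by apply: fin; exact: subIsetl.
pose P k := [set x : 'rV[R]_p | forall c, ~ O c -> k.+1%:R^-1 <= enorm (x - c)].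
have nP i j : (i <= j)%N -> P i `<=` P j.
  move=> ij x Pix c Oc; apply: le_trans (Pix c Oc).
  by rewrite lef_pV2 ?posrE// ler_nat.
pose D k := P k.+1 `\` P k.
pose phi k := fine (mu (X `&` P k)).
have phiE k : mu (X `&` P k) = (phi k)%:E by rewrite fineK.
have DE k : mu (X `&` D k) = (fine (mu (X `&` D k)))%:E by rewrite fineK.
have ring k : fine (mu (X `&` D k.+1)) + phi k <= phi k.+2.
  rewrite -lee_fin EFinD -!phiE -DE.
  have e0 : 0 < k.+1%:R^-1 - k.+2%:R^-1 :> R.
    by rewrite subr_gt0 ltf_pV2 ?posrE// ltr_nat.
  apply: le_trans (metric e0 _) (le_outer_measure mu _ _ _).
    move=> s t [_ [_ /existsNP[c /not_implyP[Oc /negP]]]].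
    rewrite -ltNge => sc [_ /(_ c Oc) tc].
    rewrite lerBlDr (le_trans tc)// (le_trans (enorm_triangle s t c))//.
    by rewrite enormBC lerD2l ltW.
  move=> x [[Xx [Px _]]|[Xx Px]]; split=> //.
  exact: (nP k k.+2 (leqW (leqnSn k)) _ Px).
have sums n j : \sum_(i < j) fine (mu (X `&` D (n.+1 + i)%N)) <=
    phi (n.+1 + j)%N + phi (n + j)%N - phi n.+1 - phi n.
  elim: j => [|j ih]; first by rewrite big_ord0 !addn0; lra.
  by rewrite big_ord_recr/=; have := ring (n + j)%N; rewrite !addnS !addSn; lra.
have bnd : has_ubound (range phi).
  exists (fine (mu X)) => _ [k _ <-]; apply: fine_le => //; first exact: fin.
  exact: le_outer_measure (@subIsetl _ _ _).
pose L := sup (range phi).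
have phiL k : phi k <= L by apply: ub_le_sup => //; exists k.
have cover n : X `&` O `<=`
    (X `&` P n.+1) `|` \bigcup_(k in ~` `I_n.+1) (X `&` D k).
  move=> x [Xx Ox]; have [r r0 xrO] := open_sub_eball oO Ox.
  have [k] : exists k, P k x.
    have [k kr] : exists k, k.+1%:R^-1 < r.
      have [k _ /(_ _ (leqnn k)) /= kr] := near_infty_natSinv_lt (PosNum r0).
      by exists k.
    exists k => c Oc; rewrite (le_trans (ltW kr))// leNgt; apply/negP => xc.
    by apply: Oc; apply: xrO; rewrite /eball/= enormBC.
  elim: k => [|k ih] Pkx; first by left; split => //; exact: (nP 0%N).
  have [|Pk] := pselect (P k x); first exact: ih.
  have [kn|nk] := ltnP k n.+1; first by left; split => //; exact: (nP k.+1).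
  by right; exists k => //=; apply/negP; rewrite -leqNgt.
have main n : fine (mu (X `&` O)) + phi n <= 2 * L.
  suff : (mu (X `&` O) <= (phi n.+1 + (2 * L - phi n.+1 - phi n))%:E)%E.
    by rewrite -(fineK (finI O)) lee_fin; lra.
  rewrite (le_trans (le_outer_measure mu _ _ (cover n)))//.
  rewrite (le_trans (outer_measureU2 _ _ _))// phiE EFinD leeD2l//.
  rewrite (le_trans (outer_measure_sigma_subadditive_tail _ _ _))//.
  apply: lime_le; first by apply: is_cvg_nneseries => *; exact: outer_measure_ge0.
  apply: nearW => m; have [mn|nm] := leqP m n.+1.
    by rewrite big_geq// lee_fin; have := phiL n; have := phiL n.+1; lra.
  rewrite -[X in \big[_/_]_(X <= _ < _) _]add0n big_addn big_mkord.
  set j := (m - n.+1)%N.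
  under eq_bigr do rewrite DE.
  rewrite sumEFin lee_fin; under eq_bigr do rewrite addnC.
  apply: le_trans (sums n _) _.
  by have := phiL (n.+1 + j)%N; have := phiL (n + j)%N; lra.
have OL : fine (mu (X `&` O)) <= L.
  suff : L <= 2 * L - fine (mu (X `&` O)) by lra.
  apply: ge_sup; first by exists (phi 0%N), 0%N.
  by move=> _ [n _ <-]; have := main n; lra.
have CL : fine (mu (X `&` ~` O)) + L <= fine (mu X).
  rewrite -lerBrDl; apply: ge_sup; first by exists (phi 0%N), 0%N.
  move=> _ [n _ <-]; rewrite lerBrDl -lee_fin EFinD -phiE !fineK//; last exact: fin.
  have e0 : 0 < n.+1%:R^-1 :> R by [].
  apply: le_trans (metric e0 _) (le_outer_measure mu _ _ _).
    by move=> s t [_ Os] [_ /(_ _ Os)]; rewrite enormBC.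
  by move=> x [[]|[]].
rewrite -(fineK (finI O)) -(fineK (finI (~` O))) -(fineK (fin _ (@subset_refl _ X))).
by rewrite -EFinD lee_fin; lra.
Qed.

Lemma borel_caratheodory (A : set (borelType R p)) :
  measurable A -> mu.-caratheodory A.
Proof.
apply: smallest_sub => [|O]; last exact: open_caratheodory.
split; first exact: caratheodory_measurable_set0.
- by move=> B mB; rewrite setTD; exact: caratheodory_measurable_setC.
- exact: caratheodory_measurable_bigcup.
Qed.

End CaratheodoryCriterion.

Section HausdorffOuterMeasure.
Variables (R : realType) (p : nat) (d : R).
Hypothesis d0 : 0 < d.
Implicit Types S U : set 'rV[R]_p.

Lemma ediam0 : ediam (set0 : set 'rV[R]_p) = 0%E.
Proof.
by rewrite /ediam setX0 image_set0 setU0 ereal_sup1.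
Qed.

Lemma enorm_le_ediam S x y : S x -> S y -> ((enorm (x - y))%:E <= ediam S)%E.
Proof. by move=> Sx Sy; apply: ereal_sup_ubound; right; exists (x, y). Qed.

Let gauge (delta : R) (U : set 'rV[R]_p) : \bar R :=
  if (ediam U <= delta%:E)%E then poweR (ediam U) d else +oo%E.

Let gauge_ge0 delta U : (0 <= gauge delta U)%E.
Proof. by rewrite /gauge; case: ifP => _; rewrite ?poweR_ge0. Qed.

Let gauge0 delta : 0 < delta -> gauge delta set0 = 0%E.
Proof. by move=> e0; rewrite /gauge ediam0 lee_fin ltW// poweR0r// gt_eqF. Qed.

Let pre (delta : R) S : \bar R := ereal_inf
  [set (\sum_(0 <= k <oo) poweR (ediam (U k)) d)%E | U in delta_cover delta S].

Let allsets := g_sigma_algebraType [set: set 'rV[R]_p].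

(** Giving an infinite gauge to the sets of too large diameter turns the infimum
    over fine covers into one over all covers, whose countable subadditivity is
    known. *)
Let preE delta S : pre delta S = mu_ext (gauge delta : set allsets -> \bar R) S.
Proof.
apply/eqP; rewrite eq_le; apply/andP; split.
  apply: le_ereal_inf_tmp => _ [F [_ SF] <-].
  have [Fd|] := pselect (forall k, (ediam (F k) <= delta%:E)%E).
    apply: ereal_inf_lbound; exists F; first by split.
    by apply: eq_eseriesr => k _; rewrite /gauge Fd.
  move=> /existsNP[k /negP Fk]; rewrite (@eseries_pinfty _ _ _ k) ?leey//.
  - by move=> n _; rewrite gt_eqF// (lt_le_trans ltNy0).
  - by rewrite /gauge (negbTE Fk).
apply: le_ereal_inf_tmp => _ [F [SF Fd] <-].
apply: ereal_inf_lbound; exists F.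
  by split => // i; exact: sub_sigma_algebra.
by apply: eq_eseriesr => k _; rewrite /gauge Fd.
Qed.

Let pre_ge0 delta S : (0 <= pre delta S)%E.
Proof. by rewrite preE; exact: mu_ext_ge0. Qed.

Let pre_anti delta delta' S : delta <= delta' -> (pre delta' S <= pre delta S)%E.
Proof.
move=> dd; apply: ereal_inf_le_tmp => _ [U [SU Ud] <-]; exists U => //.
by split=> // k; rewrite (le_trans (Ud k)).
Qed.

(** No set of diameter less than the distance of two sets meets both of them, so
    a fine cover of the union splits into covers of the two sets. *)
Let preU delta e S S' : 0 < delta -> delta < e ->
  (forall s t, S s -> S' t -> e <= enorm (s - t)) ->
  (pre delta S + pre delta S' <= pre delta (S `|` S'))%E.
Proof.
move=> dl0 de sep; rewrite !preE.
apply: le_ereal_inf_tmp => _ [F [_ SF] <-].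
have [Fd|] := pselect (forall k, (ediam (F k) <= delta%:E)%E); last first.
  move=> /existsNP[k /negP Fk]; rewrite (@eseries_pinfty _ _ _ k) ?leey//.
  - by move=> n _; rewrite gt_eqF// (lt_le_trans ltNy0).
  - by rewrite /gauge (negbTE Fk).
pose meet T k := if `[< F k `&` T !=set0 >] then F k else set0.
have meetP T : T `<=` S `|` S' ->
    (mu_ext (gauge delta : set allsets -> \bar R) T
     <= \sum_(k <oo) gauge delta (meet T k))%E.
  move=> TS; apply: ereal_inf_lbound; exists (meet T) => //.
  split; first by move=> k; exact: sub_sigma_algebra.
  move=> x Tx; have [k _ Fkx] := SF _ (TS _ Tx); exists k => //.
  by rewrite /meet asboolT//; exists x.
apply: (@le_trans _ _ (\sum_(k <oo) (gauge delta (meet S k) + gauge delta (meet S' k)))%E).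
  by rewrite nneseriesD//; apply: leeD; apply: meetP;
    [exact: subsetUl|exact: subsetUr].
apply: lee_nneseries => [k _ _|k _]; first by rewrite adde_ge0.
rewrite /meet; case: asboolP => [[s [Fs Ss]]|_]; last first.
  by rewrite gauge0// add0e; case: asboolP => // _; rewrite gauge0.
case: asboolP => [[t [Ft St]]|_]; last by rewrite gauge0// adde0.
have := le_trans (enorm_le_ediam Fs Ft) (Fd k); rewrite lee_fin => std.
by have := le_lt_trans (le_trans (sep _ _ Ss St) std) de; rewrite ltxx.
Qed.

(** The exponent must be positive for the empty set to have measure 0; taking the
    proof as an argument lets the outer measure structure be inferred. *)
Definition hausdorff_outer of 0 < d : set 'rV[R]_p -> \bar R :=
  unnormalized_hausdorff d.

Let pre_le delta S : 0 < delta -> (pre delta S <= hausdorff_outer d0 S)%E.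
Proof. by move=> ?; apply: ereal_sup_ubound; exists delta. Qed.

Let hausdorff_outer0 : hausdorff_outer d0 set0 = 0%E.
Proof.
apply/eqP; rewrite eq_le; apply/andP; split; last first.
  by apply: le_trans (pre_le _ (@ltr01 R)); exact: pre_ge0.
apply: ge_ereal_sup => _ [delta dl0 <-].
by rewrite -/(pre delta set0) preE mu_ext0//; exact: gauge0.
Qed.

Let hausdorff_outer_ge0 S : (0 <= hausdorff_outer d0 S)%E.
Proof. by apply: le_trans (pre_le _ (@ltr01 R)); exact: pre_ge0. Qed.

Let le_hausdorff_outer :
  {homo hausdorff_outer d0 : S S' / S `<=` S' >-> (S <= S')%E}.
Proof.
move=> S S' SS'; apply: ge_ereal_sup => _ [delta dl0 <-].
apply: le_trans (pre_le _ dl0).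
by rewrite -/(pre delta S) !preE; exact: le_mu_ext.
Qed.

Let hausdorff_outer_sigma_subadditive : sigma_subadditive (hausdorff_outer d0).
Proof.
move=> F; apply: ge_ereal_sup => _ [delta dl0 <-].
rewrite -/(pre delta _) preE.
apply: (le_trans (mu_ext_sigma_subadditive _ _)); first exact: gauge_ge0.
apply: lee_nneseries => [k _ _|k _]; first exact: mu_ext_ge0.
by rewrite -preE pre_le.
Qed.

HB.instance Definition _ := isOuterMeasure.Build R _ (hausdorff_outer d0)
  hausdorff_outer0 hausdorff_outer_ge0 le_hausdorff_outer
  hausdorff_outer_sigma_subadditive.

Lemma hausdorff_outer_metric (e : R) S S' : 0 < e ->
  (forall s t, S s -> S' t -> e <= enorm (s - t)) ->
  (hausdorff_outer d0 S + hausdorff_outer d0 S'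
   <= hausdorff_outer d0 (S `|` S'))%E.
Proof.
move=> e0 sep.
have [->|fin] := eqVneq (hausdorff_outer d0 (S `|` S')) +oo%E; first by rewrite leey.
have finS A : A `<=` S `|` S' -> hausdorff_outer d0 A \is a fin_num.
  move=> AS; rewrite ge0_fin_numE// (le_lt_trans (le_hausdorff_outer AS))//.
  by rewrite ltey.
rewrite -leeBrDr ?finS//.
apply: ge_ereal_sup => _ [d1 d10 <-]; rewrite -/(pre d1 S).
rewrite leeBrDr ?finS//.
rewrite addeC -leeBrDr; last first.
  rewrite ge0_fin_numE// (le_lt_trans (pre_le _ d10))//.
  by rewrite -ge0_fin_numE// finS//; exact: subsetUl.
apply: ge_ereal_sup => _ [d2 d20 <-]; rewrite -/(pre d2 S').
rewrite leeBrDr; last first.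
  rewrite ge0_fin_numE// (le_lt_trans (pre_le _ d10))//.
  by rewrite -ge0_fin_numE// finS//; exact: subsetUl.
pose dl := Num.min (Num.min d1 d2) (e / 2).
have dl0 : 0 < dl by rewrite !lt_min d10 d20 divr_gt0.
have dle : dl < e.
  by rewrite (@le_lt_trans _ _ (e / 2))//; [rewrite ge_min lexx orbT|lra].
rewrite addeC; apply: (@le_trans _ _ (pre dl S + pre dl S')%E).
  by apply: leeD; apply: pre_anti; rewrite !ge_min lexx ?orbT.
by rewrite (le_trans (preU dl0 dle sep))// pre_le.
Qed.

Definition hausdorff_measure : set (borelType R p) -> \bar R :=
  hausdorff_outer d0.

Let hausdorff_semi_sigma_additive : semi_sigma_additive hausdorff_measure.
Proof.
have bc := borel_caratheodory hausdorff_outer_metric.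
move=> F mF tF mUF; apply: caratheodory_measure_sigma_additive => //.
  by move=> i; exact: (bc _ (mF i)).
exact: (bc _ mUF).
Qed.

HB.instance Definition _ := isMeasure.Build _ _ _ hausdorff_measure
  hausdorff_outer0 hausdorff_outer_ge0 hausdorff_semi_sigma_additive.

End HausdorffOuterMeasure.

Section RegularSets.
Variables (R : realType) (p : nat) (d : R) (A : set 'rV[R]_p).

(** Hausdorff measure on [A] near [y0], in the form in which regularity is used.
    The restriction to a ball makes the measure finite, and a second point of [A]
    gives a positive range of radii. *)
Lemma d_regular_finite_measure (y0 : 'rV[R]_p) :
  d_regular d A -> A y0 -> A <> [set y0] ->
  exists (nu : {finite_measure set (borelType R p) -> \bar R}) (c C rho : R),
    [/\ nu (~` A) = 0%E, [/\ 0 < c, 0 < C & 0 < rho],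
      forall y r, A y -> 0 < r < rho -> (nu (eball y r) <= (C * r `^ d)%:E)%E &
      forall r, 0 < r < rho -> ((c * r `^ d)%:E <= nu (eball y0 r))%E].
Proof.
move=> [cA /andP[d0 _] [c [C [c0 C0 Areg]]]] Ay0 Any0.
have [y1 Ay1 y10] : exists2 y1, A y1 & y1 != y0.
  apply: contra_notP Any0 => /forall2NP Any0; apply/seteqP; split=> [x Ax|x ->//].
  by have [//|/negP] := Any0 x; rewrite negbK => /eqP.
have rho0 : 0 < enorm (y1 - y0).
  rewrite lt_neqAle enorm_ge0 andbT eq_sym; apply: contra_neq y10 => /enorm_eq0/eqP.
  by rewrite subr_eq0 => /eqP.
set rho := enorm _ in rho0.
have Adiam r : r < rho -> (r%:E < ediam A)%E.
  move=> rr; apply: (@lt_le_trans _ _ rho%:E); first by rewrite lte_fin.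
  exact: enorm_le_ediam.
pose H := hausdorff_measure d0 : {measure set (borelType R p) -> \bar R}.
have HE S : H S = unnormalized_hausdorff d S by [].
(* the normalizing constant is an inverse, which might vanish; regularity at one
   radius rules this out *)
have [k [k0 kE]] : exists k : R, 0 < k /\
    forall S : set 'rV[R]_p, hausdorff d S = (k%:E * H S)%E.
  pose k : R := if d \is a Num.nat
     then (fine (unnormalized_hausdorff d
                   (unit_cube (Num.truncn d) : set 'rV[R]_p)))^-1
     else 1.
  have kE S : hausdorff d S = (k%:E * H S)%E by [].
  exists k; split => //; rewrite lt_neqAle; apply/andP; split.
    apply/eqP => k0; have r20 : 0 < rho / 2 by rewrite divr_gt0.
    have r2 : ((rho / 2)%:E < ediam A)%E by apply: Adiam; lra.
    have /andP[+ _] := Areg y0 _ Ay0 r20 r2.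
    by rewrite kE -k0 mul0e lee_fin leNgt mulr_gt0// powR_gt0.
  rewrite /k; case: ifP => // _; rewrite invr_ge0 fine_ge0//.
  exact: (outer_measure_ge0 (hausdorff_outer d0)).
have mB y r : measurable (eball y r `&` A : set (borelType R p)).
  by apply: measurableI; [exact: measurable_eball|exact: compact_measurable_rV].
have Hle y r : A y -> 0 < r < rho ->
    (H (eball y r `&` A) <= (k^-1 * C * r `^ d)%:E)%E.
  move=> Ay /andP[r0 rr]; have /andP[_] := Areg y r Ay r0 (Adiam _ rr).
  by rewrite kE muleC -lee_pdivlMr// muleC -EFinM mulrA.
have Hge r : 0 < r < rho ->
    ((k^-1 * c * r `^ d)%:E <= H (eball y0 r `&` A))%E.
  move=> /andP[r0 rr]; have /andP[+ _] := Areg y0 r Ay0 r0 (Adiam _ rr).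
  by rewrite kE muleC -lee_pdivrMr// muleC -EFinM mulrA.
pose B := eball y0 (rho / 2) `&` A.
have rho2 : 0 < rho / 2 < rho by apply/andP; lra.
have BO : (H B < +oo)%E by rewrite (le_lt_trans (Hle _ _ Ay0 rho2))// ltry.
pose nu : {finite_measure set (borelType R p) -> \bar R} :=
  mfrestr (mB y0 (rho / 2)) BO.
exists nu, (k^-1 * c), (k^-1 * C), (rho / 2).
have nuE S : nu S = H (S `&` B) by [].
split.
- by rewrite nuE setIC -setIA setICr setI0 measure0.
- by split; [rewrite mulr_gt0 ?invr_gt0..|lra].
- move=> y r Ay /andP[r0 rr].
  have r0r : 0 < r < rho by apply/andP; lra.
  rewrite nuE (le_trans _ (Hle _ _ Ay r0r))// le_measure ?inE//.
    exact: measurableI (measurable_eball _ _) (mB _ _).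
  by move=> x [? []].
- move=> r /andP[r0 rr].
  have r0r : 0 < r < rho by apply/andP; lra.
  rewrite nuE (le_trans (Hge _ r0r))// le_measure ?inE//.
    exact: measurableI (measurable_eball _ _) (mB _ _).
  by move=> x [xr Ax]; split => //; split => //; exact: lt_trans xr rr.
Qed.

End RegularSets.

(** * Riesz-like kernels *)

Section RieszKernel.
Variables (R : realType) (d : R) (f : R -> R).
Hypothesis rf : riesz_like d f.
Implicit Types s t r : R.

Lemma riesz_like_gt0 t : 0 < t -> 0 < f t.
Proof. by case: rf => + _ _ _ t0; apply; rewrite in_itv/= t0. Qed.

Let f_anti s t : 0 < s -> s <= t -> f t <= f s.
Proof.
case: rf => _ _ fd _ s0; rewrite le_eqVlt => /predU1P[->//|st].
by apply/ltW/fd; rewrite ?in_itv/= ?s0 ?(lt_trans s0).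
Qed.

Lemma extend0_gt0 t : 0 < t -> extend0 f t = (f t)%:E.
Proof. by move=> t0; rewrite /extend0 gt_eqF. Qed.

Lemma extend0_cvg : (f s)%:E @[s --> 0^'+] --> extend0 f 0.
Proof.
rewrite /extend0 eqxx; apply: (@nonincreasing_at_right_is_cvge _ (EFin \o f)).
near=> x => s t; rewrite !in_itv/= => /andP[s0 _] /andP[t0 _] st.
by rewrite lee_fin f_anti.
Unshelve. all: by end_near. Qed.

Lemma le_extend0_0 t : 0 < t -> ((f t)%:E <= extend0 f 0)%E.
Proof.
move=> t0; apply: (cvge_ge _ extend0_cvg).
near=> s; rewrite lee_fin f_anti//; near: s.
exact: nbhs_right_le.
Unshelve. all: by end_near. Qed.

Lemma extend0_anti s t : 0 <= s -> s <= t -> (extend0 f t <= extend0 f s)%E.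
Proof.
rewrite le_eqVlt => /predU1P[<-|s0] st.
  move: st; rewrite le_eqVlt => /predU1P[<-//|t0].
  by rewrite [leLHS]extend0_gt0// le_extend0_0.
rewrite !extend0_gt0//; last exact: lt_le_trans st.
by rewrite lee_fin f_anti.
Qed.

Lemma extend0_ge0 t : 0 <= t -> (0 <= extend0 f t)%E.
Proof.
move=> t0; apply: (@le_trans _ _ (extend0 f (t + 1))); last by rewrite extend0_anti// lerDl.
by rewrite extend0_gt0 ?ltr_wpDl// lee_fin ltW// riesz_like_gt0// ltr_wpDl.
Qed.

(** The extended kernel is continuous on the closed half-line, with possibly an
    infinite value at 0. *)
Lemma extend0_cvg_seq (v : R^nat) t : (forall n, 0 <= v n) -> v @ \oo --> t ->
  0 <= t -> extend0 f (v n) @[n --> \oo] --> extend0 f t.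
Proof.
move=> v0 vt; rewrite le_eqVlt => /predU1P[t0|t0].
  move: vt; rewrite -t0 => vt U /[dup] U0 /extend0_cvg[e /= e0 eU].
  move/cvgrPdist_lt : vt => /(_ e e0); apply: filterS => n.
  rewrite sub0r normrN ger0_norm// => vne /=.
  have := v0 n; rewrite le_eqVlt => /predU1P[<-|vn0]; first exact: nbhs_singleton.
  by rewrite extend0_gt0//; apply: eU => //=; rewrite sub0r normrN gtr0_norm.
have fv0 : f (v n) @[n --> \oo] --> f t.
  apply: continuous_cvg => //.
  by case: rf => _ + _ _; apply; rewrite in_itv/= t0.
have fv : (f (v n))%:E @[n --> \oo] --> (f t)%:E.
  by apply/cvg_EFin; [exact: nearW|exact: fv0].
rewrite extend0_gt0//; apply: cvg_trans fv; apply: near_eq_cvg.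
near=> n; rewrite extend0_gt0//; near: n.
exact: (cvgr_gt _ vt).
Unshelve. all: by end_near. Qed.

Lemma measurable_extend0 : measurable_fun (`[0, +oo[%classic : set R) (extend0 f).
Proof.
have -> : (`[0, +oo[%classic : set R) = [set 0 : R] `|` `]0, +oo[%classic.
  by rewrite setU1itv.
apply/measurable_funU => //; split; first exact: measurable_fun_set1.
apply: (eq_measurable_fun (EFin \o f)).
  by move=> t; rewrite inE/= in_itv/= andbT => t0; rewrite extend0_gt0.
apply/measurable_EFinP; apply: open_continuous_measurable_fun; first exact: interval_open.
by move=> t tI; case: rf => _ + _ _; apply; rewrite inE in tI.
Qed.

(** The growth of [f] near the origin is that of a power with exponent below [d];
    this makes the kernel integrable against a [d]-dimensional measure, and gives
    the doubling property when [r = 2 s]. *)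
Lemma riesz_like_growth : exists a delta : R,
  [/\ 0 < a < d, 0 < delta &
      forall s r, 0 < s -> s <= r -> r <= delta -> f s <= (r / s) `^ a * f r].
Proof.
have [_ _ _ [eps [delta [/andP[e0 ed] dl0 fmono]]]] := rf.
exists (d - eps), delta; split => //; first by apply/andP; lra.
move=> s r s0 sr rd; have r0 := lt_le_trans s0 sr.
have s_in : s \in `[0, delta] by rewrite in_itv/= ltW//= (le_trans sr rd).
have r_in : r \in `[0, delta] by rewrite in_itv/= ltW.
have := fmono s r s_in r_in sr.
rewrite /extend0 !gt_eqF// lee_fin => fsr.
rewrite powRM ?invr_ge0 ?(ltW r0) ?(ltW s0)// -[s^-1]powR_inv1 ?(ltW s0)//.
rewrite -powRrM mulN1r powRN.
by rewrite mulrAC ler_pdivlMr ?powR_gt0// mulrC.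
Qed.

End RieszKernel.

Section KernelOfDistance.
Variables (R : realType) (p : nat) (d : R) (f : R -> R).
Hypothesis rf : riesz_like d f.

Lemma measurable_distance_kernel2 : measurable_fun setT
  (fun z : borelType R p * borelType R p =>
    extend0 f (enorm ((z.1 : 'rV[R]_p) - z.2))).
Proof.
apply: (@measurable_comp _ _ _ _ _ _ (`[0, +oo[%classic : set R) (extend0 f)) => //.
- by move=> _ [z _ <-] /=; rewrite in_itv/= enorm_ge0.
- exact: measurable_extend0 rf.
- exact: measurable_enormB.
Qed.

Lemma measurable_distance_kernel (y : 'rV[R]_p) (t : R) : 0 <= t -> measurable_fun setT
  (fun x : borelType R p => extend0 f (enorm ((x : 'rV[R]_p) - y) + t)).
Proof.
move=> t0; apply: (@measurable_comp _ _ _ _ _ _ (`[0, +oo[%classic : set R) (extend0 f)) => //.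
- by move=> _ [z _ <-] /=; rewrite in_itv/= addr_ge0 ?enorm_ge0.
- exact: measurable_extend0 rf.
- apply: measurable_funD => //.
  exact: (measurableT_comp (@measurable_enormB R p) (pair2_measurable (y : borelType R p))).
Qed.

Lemma distance_kernel_ge0 (x y : 'rV[R]_p) : (0 <= extend0 f (enorm (x - y)))%E.
Proof. by apply: (extend0_ge0 rf); exact: enorm_ge0. Qed.

Lemma measurable_distance_kernel0 (y : 'rV[R]_p) : measurable_fun setT
  (fun x : borelType R p => extend0 f (enorm ((x : 'rV[R]_p) - y))).
Proof.
have := measurable_distance_kernel y (lexx 0).
by under eq_fun do rewrite addr0.
Qed.

End KernelOfDistance.

(** * Potentials of upper regular measures *)

Section IntegrationLemmas.
Variables (R : realType) (dT : measure_display) (T : measurableType dT).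

Lemma ge0_integral_conull (mu : {measure set T -> \bar R}) (A : set T)
    (g : T -> \bar R) :
  measurable A -> mu (~` A) = 0%E -> measurable_fun setT g ->
  (forall x, (0 <= g x)%E) ->
  (\int[mu]_(x in A) g x = \int[mu]_x g x)%E.
Proof.
move=> mA muA mg g0; rewrite [RHS](@ge0_negligible_integral _ _ _ _ _ (~` A))//.
  by rewrite setTD setCK.
exact: measurableC.
Qed.

End IntegrationLemmas.

Lemma sum_expr_le (R : realFieldType) (q : R) n : 0 <= q < 1 ->
  \sum_(i < n) q ^+ i <= (1 - q)^-1.
Proof.
move=> /andP[q0 q1]; have q10 : 0 < 1 - q by rewrite subr_gt0.
rewrite -(ler_pM2l q10) mulfV ?gt_eqF// -opprB mulNr -subrX1 opprB.
by rewrite lerBlDr lerDl exprn_ge0.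
Qed.

Lemma dyadic_scale (R : realType) (t : R) : 0 < t < 1 ->
  exists k : nat, 2^-1 ^+ k.+1 <= t < 2^-1 ^+ k.
Proof.
move=> /andP[t0 t1].
have h0 : `|2^-1 : R| < 1 by rewrite ger0_norm// invf_lt1// ltr1n.
have [n] : exists n, 2^-1 ^+ n <= t.
  have /cvgrPdist_lt/(_ _ t0)[n _ /(_ _ (leqnn n))/=] := cvg_expr h0.
  by rewrite sub0r normrN ger0_norm ?exprn_ge0// => /ltW; exists n.
elim: n => [|n ih] nt; first by move: t1; rewrite ltNge nt.
by have [/ih//|tn] := leP (2^-1 ^+ n) t; exists n; rewrite nt tn.
Qed.

Section UpperRegularMeasure.
Variables (R : realType) (p : nat) (d : R) (A : set 'rV[R]_p) (f : R -> R).
Variables (nu : {finite_measure set (borelType R p) -> \bar R}) (C rho : R).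
Implicit Types (x y z : 'rV[R]_p) (r : R).
Hypotheses (rf : riesz_like d f) (C0 : 0 < C) (rho0 : 0 < rho).
Hypothesis nu_ball : forall y r, A y -> 0 < r < rho ->
  (nu (eball y r) <= (C * r `^ d)%:E)%E.

(** On the shell where [r / 2 ^ (k + 1) <= |x - z| < r / 2 ^ k] the [k]-th term
    alone dominates the kernel, by monotonicity. *)
Let shells z r x : 0 < r -> eball z r x ->
  (extend0 f (enorm (x - z)) <= \sum_(k <oo)
     ((f (2^-1 ^+ k.+1 * r))%:E * (\1_(eball z (2^-1 ^+ k * r)) x)%:E))%E.
Proof.
move=> r0; set s := enorm (x - z); rewrite /eball/= -/s => sr.
have h0 k : 0 < 2^-1 ^+ k * r by rewrite mulr_gt0 ?exprn_gt0.
have fh k : 0 < f (2^-1 ^+ k * r).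
  exact: (riesz_like_gt0 rf).
pose u k := ((f (2^-1 ^+ k.+1 * r))%:E * (\1_(eball z (2^-1 ^+ k * r)) x)%:E)%E.
have u0 k : (0 <= u k)%E by rewrite mule_ge0// lee_fin// ltW.
have le_series k : (u k <= \sum_(k <oo) u k)%E.
  apply: le_trans (@nneseries_lim_ge R u xpredT 0 k.+1 _); last by move=> *; exact: u0.
  by rewrite big_nat_recr//= leeDr// sume_ge0.
have uE k : s < 2^-1 ^+ k * r -> u k = (f (2^-1 ^+ k.+1 * r))%:E.
  by move=> sk; rewrite /u indicE mem_set ?mule1.
have := enorm_ge0 (x - z); rewrite -/s le_eqVlt => /predU1P[s0|s0].
  (* at the center the kernel is the limit of its values on the shells *)
  have cvh : (fun k => 2^-1 ^+ k.+1 * r) @ \oo --> (0 : R).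
    rewrite -[X in _ --> X](mul0r r); apply: cvgMr_tmp.
    have : (fun k => 2^-1 ^+ k : R) @ \oo --> (0 : R).
      by apply: cvg_expr; rewrite ger0_norm// invf_lt1// ltr1n.
    by rewrite -cvg_shiftS.
  have := extend0_cvg_seq rf (fun k => ltW (h0 k.+1)) cvh (lexx 0).
  rewrite -s0 => fc; apply: (cvge_le _ fc); apply: nearW => k.
  by rewrite extend0_gt0//; apply: le_trans (le_series k); rewrite uE// -s0.
have [k /andP[ks sk]] : exists k : nat, 2^-1 ^+ k.+1 <= s / r < 2^-1 ^+ k.
  by apply: dyadic_scale; rewrite divr_gt0//= ltr_pdivrMr// mul1r.
apply: le_trans (le_series k).
rewrite uE -?ltr_pdivrMr// -extend0_gt0//.
by apply: (extend0_anti rf); [exact: ltW|rewrite -ler_pdivlMr].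
Qed.

(** The mass of a ball of radius [r] compensates the growth of the kernel: shell
    by shell, [f (r / 2 ^ k) * (r / 2 ^ k) ^ d] decays geometrically. *)
Lemma ball_potential_le : exists K delta : R, [/\ 0 < K, 0 < delta < rho &
  forall z r, A z -> 0 < r <= delta ->
  (\int[nu]_(x in eball z r) extend0 f (enorm ((x : 'rV[R]_p) - z))
    <= (K * r `^ d * f r)%:E)%E].
Proof.
have [a [del [/andP[a0 ad] del0 growth]]] := riesz_like_growth rf.
pose q : R := 2^-1 `^ (d - a).
have q01 : 0 <= q < 1.
  rewrite powR_ge0/=; have : 2^-1 `^ (d - a) < 1 `^ (d - a) :> R.
    by apply: gt0_ltr_powR; rewrite ?nnegrE ?subr_gt0// invf_lt1// ltr1n.
  by rewrite powR1.
pose K := C * 2 `^ a * (1 - q)^-1.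
exists K, (Num.min del (rho / 2)); split.
- by rewrite !mulr_gt0 ?powR_gt0// invr_gt0 subr_gt0; case/andP: q01.
- rewrite lt_min del0 divr_gt0//= gt_min; apply/orP; right.
  by rewrite gtr_pMr// invf_lt1// ltr1n.
move=> z r Az /andP[r0]; rewrite le_min => /andP[rdel rrho].
have h0 k : 0 < 2^-1 ^+ k * r by rewrite mulr_gt0 ?exprn_gt0.
have hr k : 2^-1 ^+ k * r <= r.
  by rewrite ger_pMl// exprn_ile1// invf_le1// ler1n.
have f0 t : 0 < t -> 0 < f t by exact: (riesz_like_gt0 rf).
pose u k (x : borelType R p) :=
  ((f (2^-1 ^+ k.+1 * r))%:E * (\1_(eball z (2^-1 ^+ k * r)) x)%:E)%E.
have u0 k x : (0 <= u k x)%E by rewrite mule_ge0// lee_fin// ltW// f0.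
have mind k : measurable_fun setT
    (fun x : borelType R p => (\1_(eball z (2^-1 ^+ k * r)) x)%:E : \bar R).
  by apply/measurable_EFinP; apply: measurable_indic; exact: measurable_eball.
have mu k : measurable_fun setT (u k).
  by apply: emeasurable_funM => //; exact: mind.
have mB : measurable (eball z r : set (borelType R p)) by exact: measurable_eball.
apply: (@le_trans _ _ (\int[nu]_(x in eball z r) \sum_(k <oo) u k x)%E).
  apply: ge0_le_integral => //.
  - by move=> x _; exact: (distance_kernel_ge0 rf).
  - by apply: measurable_funTS; exact: (measurable_distance_kernel0 rf).
  - by apply: measurable_funTS; apply: ge0_emeasurable_sum.
  - by move=> x; exact: shells.
rewrite integral_nneseries//; last by move=> k; exact: measurable_funTS.
have termE k : (\int[nu]_(x in eball z r) u k x <=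
    (C * 2 `^ a * (r `^ d * f r) * q ^+ k)%:E)%E.
  rewrite /u ge0_integralZl_EFin//; last 2 first.
    - exact: measurable_funTS.
    - by rewrite ltW// f0.
  rewrite integral_indic//; last exact: measurable_eball.
  have hk : 0 < 2^-1 ^+ k * r < rho by rewrite h0/= (le_lt_trans (hr k))//; lra.
  apply: (@le_trans _ _ ((f (2^-1 ^+ k.+1 * r))%:E
      * (C * (2^-1 ^+ k * r) `^ d)%:E)%E).
    apply: lee_wpmul2l; first by rewrite lee_fin ltW// f0.
    apply: le_trans (nu_ball Az hk); rewrite le_measure ?inE//.
    + by apply: measurableI => //; exact: measurable_eball.
    + exact: measurable_eball.
  rewrite -EFinM lee_fin.
  have := growth _ r (h0 k.+1) (hr k.+1) rdel.
  have -> : r / (2^-1 ^+ k.+1 * r) = 2 ^+ k.+1.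
    by rewrite invfM mulrCA mulfV ?gt_eqF// mulr1 exprVn invrK.
  have expow (x b : R) n : 0 <= x -> (x ^+ n) `^ b = (x `^ b) ^+ n.
    by move=> x0; rewrite -powR_mulrn// powRAC powR_mulrn// powR_ge0.
  rewrite (expow 2)// powRM ?exprn_ge0 ?(ltW r0)// (expow 2^-1)//.
  move=> /(ler_wpM2r (_ : 0 <= C * ((2^-1 `^ d) ^+ k * r `^ d))) => /(_ _)/le_trans; apply.
    by rewrite !mulr_ge0 ?exprn_ge0 ?powR_ge0 ?(ltW C0).
  have -> : q = 2^-1 `^ d * 2 `^ a.
    rewrite /q powRB; last by rewrite invr_eq0 pnatr_eq0 implybT.
    by congr (_ * _); rewrite -[2^-1]powR_inv1// -powRrM mulN1r powRN invrK.
  by rewrite exprMn exprS le_eqVlt; apply/orP; left; apply/eqP; ring.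
apply: lime_le.
  by apply: is_cvg_nneseries => k _ _; apply: integral_ge0 => x _; exact: u0.
apply: nearW => n; apply: (@le_trans _ _
    (\sum_(0 <= k < n) (C * 2 `^ a * (r `^ d * f r) * q ^+ k)%:E)%E).
  by apply: lee_sum => k _; exact: termE.
rewrite sumEFin lee_fin -mulr_sumr big_mkord.
rewrite (_ : K * _ * _ = C * 2 `^ a * (r `^ d * f r) * (1 - q)^-1); last by rewrite /K; ring.
by rewrite ler_wpM2l ?sum_expr_le// !mulr_ge0 ?powR_ge0 ?ltW// f0.
Qed.

(** A fixed ball around the pole contributes a bounded amount; away from it the
    kernel is bounded and [nu] is finite. *)
Lemma upper_regular_potential_bounded : exists K : R, forall y, A y ->
  (\int[nu]_x extend0 f (enorm ((x : 'rV[R]_p) - y)) <= K%:E)%E.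
Proof.
have [K [r [K0 /andP[r0 _] Kle]]] := ball_potential_le.
have nuT : nu setT \is a fin_num by exact: fin_num_measure.
exists (K * r `^ d * f r + f r * fine (nu setT)) => y Ay.
have mB : measurable (eball y r : set (borelType R p)) by exact: measurable_eball.
rewrite -(setUv (eball y r)) ge0_integral_setU//=; last 4 first.
- exact: measurableC.
- by rewrite setUv; exact: (measurable_distance_kernel0 rf).
- by move=> x _; exact: (distance_kernel_ge0 rf).
- exact/disj_setPCl.
rewrite EFinD leeD ?Kle ?r0 ?lexx//.
apply: (@le_trans _ _ (\int[nu]_(x in ~` eball y r) (f r)%:E)%E).
  apply: ge0_le_integral => //.
  - exact: measurableC.
  - by move=> x _; exact: (distance_kernel_ge0 rf).
  - by apply: measurable_funTS; exact: (measurable_distance_kernel0 rf).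
  - move=> x /negP; rewrite -leNgt => rx.
    by rewrite -extend0_gt0// (extend0_anti rf)// ltW.
rewrite integral_cst//=; last exact: measurableC.
have fr : 0 <= f r by exact/ltW/(riesz_like_gt0 rf).
rewrite setUv EFinM fineK// lee_wpmul2l ?lee_fin// le_measure ?inE//.
exact: measurableC.
Qed.

End UpperRegularMeasure.

(** * Potentials on the exceptional set *)

Section Potentials.
Variables (R : realType) (p : nat) (d : R) (A : set 'rV[R]_p) (f : R -> R).
Hypotheses (rf : riesz_like d f) (cA : compact A).
Implicit Types (x y z : 'rV[R]_p).

Lemma potentialE (mu : {measure set (borelType R p) -> \bar R}) y :
  measure_on A mu ->
  potential A f mu y =
  (\int[mu]_x extend0 f (enorm ((x : 'rV[R]_p) - y)))%E.
Proof.
move=> muA; apply: ge0_integral_conull => //.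
- exact: compact_measurable_rV.
- exact: (measurable_distance_kernel0 rf).
- by move=> x; exact: (distance_kernel_ge0 rf).
Qed.

(** Lower semicontinuity of the potential: moving the pole by less than [t] lowers
    the kernel at most to its value at a distance larger by [t], and the integrals
    of these shifted kernels increase to the potential as [t] tends to 0. *)
Lemma closed_potential_le (mu : {measure set (borelType R p) -> \bar R})
    (b : \bar R) : closed [set y |
      (\int[mu]_x extend0 f (enorm ((x : 'rV[R]_p) - y)) <= b)%E].
Proof.
move=> y cly.
pose g (n : nat) (x : borelType R p) :=
  extend0 f (enorm ((x : 'rV[R]_p) - y) + n.+1%:R^-1).
have t0 n : 0 <= n.+1%:R^-1 :> R by [].
have g0 n x : (0 <= g n x)%E.
  by apply: (extend0_ge0 rf); rewrite addr_ge0 ?enorm_ge0.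
have gcvg x : g n x @[n --> \oo] --> extend0 f (enorm (x - y)).
  apply: (extend0_cvg_seq rf) => [n||]; last exact: enorm_ge0.
    by rewrite addr_ge0 ?enorm_ge0.
  rewrite -[X in _ --> X]addr0; apply: cvgD; first exact: cvg_cst.
  exact: cvg_harmonic.
have gint : (\int[mu]_x g n x)%E @[n --> \oo] -->
    (\int[mu]_x extend0 f (enorm ((x : 'rV[R]_p) - y)))%E.
  have -> : (fun x : borelType R p => extend0 f (enorm ((x : 'rV[R]_p) - y))) =
      (fun x => limn (g ^~ x)).
    by apply/funext => x; apply/esym/cvg_lim => //; exact: gcvg.
  apply: cvg_monotone_convergence => //.
  - by move=> n; exact: (measurable_distance_kernel rf y (t0 n)).
  - move=> x _ m n mn; apply: (extend0_anti rf); first by rewrite addr_ge0 ?enorm_ge0.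
    by rewrite lerD2l lef_pV2 ?posrE// ler_nat.
apply: (cvge_le _ gint); apply: nearW => n.
have n0 : 0 < n.+1%:R^-1 :> R by [].
have [y' y'b yy'] := closure_eball cly n0.
apply: le_trans y'b; apply: ge0_le_integral => //.
- exact: (measurable_distance_kernel rf y (t0 n)).
- exact: (measurable_distance_kernel0 rf).
- move=> x _; apply: (extend0_anti rf); first exact: enorm_ge0.
  by rewrite (le_trans (enorm_triangle y x y'))// lerD2l enormBC ltW.
Qed.

(** The points where the potential is too small form a countable union of
    compact subsets of the exceptional set, on each of which a measure of
    bounded potential vanishes. *)
Lemma ae_potential_ge (mu nu : {measure set (borelType R p) -> \bar R})
    (M K : R) (E : set 'rV[R]_p) :
  measure_on A mu -> measure_on A nu -> f_negligible A f E ->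
  (forall y, A y -> (potential A f nu y <= K%:E)%E) ->
  (forall y, (A `\` E) y -> (M%:E <= potential A f mu y)%E) ->
  {ae nu, forall y, (M%:E <= potential A f mu y)%E}.
Proof.
move=> muA nuA [_ Enegl] nuK muM.
pose Z n := A `&` [set y | (potential A f mu y <= (M - n.+1%:R^-1)%:E)%E].
have cZ n : compact (Z n).
  apply: (subclosed_compact _ cA); last exact: subIsetl.
  apply: closedI; first by apply: compact_closed => //; exact: rV_hausdorff.
  under eq_set do rewrite potentialE//.
  exact: closed_potential_le.
have nuZ n : nu.-negligible (Z n).
  apply/negligibleP; first exact: compact_measurable_rV.
  apply: Enegl => //; last by exists K => y [Ay _]; exact: nuK.
  move=> y [Ay /= yM]; apply: contrapT => Ey.
  have := le_trans (muM y (conj Ay Ey)) yM.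
  by rewrite lee_fin lerBrDr gerDl leNgt invr_gt0 ltr0n.
have nuAC : nu.-negligible (~` A).
  by apply/negligibleP => //; apply: measurableC; exact: compact_measurable_rV.
apply: negligibleS (negligibleU nuAC (negligible_bigcup nuZ)) => y /= /negP.
rewrite -ltNge => yM; have [Ay|] := pselect (A y); last by left.
right; have [n ynM] : exists n : nat,
    (potential A f mu y <= (M - n.+1%:R^-1)%:E)%E.
  move: yM; case: (potential A f mu y) => [u|//|_]; last by exists 0%N; rewrite leNye.
  rewrite lte_fin -subr_gt0 => uM.
  have [n _ /(_ _ (leqnn n)) /= nuM] := near_infty_natSinv_lt (PosNum uM).
  by exists n; rewrite lee_fin lerBrDr -lerBrDl ltW.
by exists n.
Qed.

End Potentials.

(** * Averages of a potential over small balls *)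

Section Averages.
Variables (R : realType) (dT : measure_display) (T : measurableType dT).

Lemma average_between (nu : {measure set T -> \bar R}) (B : set T) (m : R)
    (g : T -> \bar R) (l u : \bar R) :
  measurable B -> nu B = m%:E -> 0 < m -> measurable_fun setT g ->
  (0 <= l)%E -> (forall y, B y -> (l <= g y <= u)%E) ->
  (l <= m^-1%:E * \int[nu]_(y in B) g y <= u)%E.
Proof.
move=> mB nuB m0 mg l0 lgu.
have E (k : \bar R) : (m^-1%:E * (k * m%:E) = k)%E.
  by rewrite muleCA -EFinM mulVf ?gt_eqF// mule1.
have m10 : (0 <= m^-1%:E)%E by rewrite lee_fin invr_ge0 ltW.
have g0 y : B y -> (0 <= g y)%E.
  by move=> By; have /andP[lg _] := lgu y By; exact: le_trans lg.
have u0 y : B y -> (0 <= u)%E.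
  by move=> By; have /andP[_ gu] := lgu y By; apply: le_trans gu; exact: g0.
apply/andP; split.
  rewrite -(E l) lee_wpmul2l// -nuB -integral_cst//.
  apply: ge0_le_integral => //; first exact: measurable_funTS.
  by move=> y By; have /andP[] := lgu y By.
rewrite -(E u) lee_wpmul2l// -nuB -integral_cst//.
apply: ge0_le_integral => //; first exact: measurable_funTS.
by move=> y By; have /andP[] := lgu y By.
Qed.

End Averages.

Section AveragedPotential.
Variables (R : realType) (p : nat) (d : R) (A : set 'rV[R]_p) (f : R -> R).
Hypotheses (rf : riesz_like d f) (cA : compact A).
Variables (mu nu : {finite_measure set (borelType R p) -> \bar R}).
Implicit Types (x y : 'rV[R]_p) (r : R).

Let k (x y : borelType R p) : \bar R :=
  extend0 f (enorm ((x : 'rV[R]_p) - (y : 'rV[R]_p))).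

Let k0 x y : (0 <= k x y)%E.
Proof. exact: (distance_kernel_ge0 rf). Qed.

Let mk2 : measurable_fun setT
  (fun z : borelType R p * borelType R p => k z.1 z.2).
Proof. exact: (measurable_distance_kernel2 rf). Qed.

Let mk y : measurable_fun setT (k ^~ y).
Proof. exact: (measurable_distance_kernel0 rf). Qed.

Let mk' x : measurable_fun setT (k x).
Proof.
rewrite (_ : k x = k ^~ x)//.
by apply/funext => y; rewrite /k enormBC.
Qed.

Lemma integral_potential (B : set (borelType R p)) : measurable B ->
  measurable_fun setT
    (fun x : borelType R p => \int[nu]_(y in B) k x y)%E /\
  (\int[mu]_x \int[nu]_(y in B) k x y = \int[nu]_(y in B) \int[mu]_x k x y)%E.
Proof.
move=> mB.
pose h (z : borelType R p * borelType R p) := (k z.1 z.2 * (\1_B z.2)%:E)%E.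
have h0 z : (0 <= h z)%E by rewrite mule_ge0.
have mh : measurable_fun setT h.
  apply: emeasurable_funM => //; apply/measurable_EFinP.
  have mB1 : measurable_fun setT (\1_B : borelType R p -> R).
    exact: measurable_indic.
  exact: (measurableT_comp mB1 (@measurable_snd _ _ _ _)).
have Fh (x : borelType R p) : (\int[nu]_(y in B) k x y = fubini_F nu h x)%E.
  by rewrite integral_mkcond epatch_indic.
have Gh (y : borelType R p) : ((fun y => \int[mu]_x k x y)%E \_ B) y = fubini_G mu h y.
  rewrite epatch_indic /fubini_G /h/= ge0_integralZr//.
split.
  by under eq_fun do rewrite Fh; exact: measurable_fun_fubini_tonelli_F.
under eq_integral do rewrite Fh.
rewrite [RHS]integral_mkcond; under [RHS]eq_integral do rewrite Gh.
exact: fubini_tonelli.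
Qed.

Let measurable_potential :
  measurable_fun setT (fun y : borelType R p => \int[mu]_x k x y)%E.
Proof.
have k20 (z : borelType R p * borelType R p) : (0 <= k z.1 z.2)%E by exact: k0.
exact: (@measurable_fun_fubini_tonelli_G _ _ _ _ _ mu _ mk2 k20).
Qed.

(** The averages of the kernel over the balls around [y0] converge to the kernel
    with pole [y0], and regularity bounds them by a multiple of it plus a constant,
    so that the averages of the potential converge to its value at [y0]. *)
Lemma potential_ge_of_ae (M c C rho : R) y0 :
  A y0 -> 0 < c -> 0 < C -> 0 < rho -> 0 <= M ->
  (forall y r, A y -> 0 < r < rho -> (nu (eball y r) <= (C * r `^ d)%:E)%E) ->
  (forall r, 0 < r < rho -> ((c * r `^ d)%:E <= nu (eball y0 r))%E) ->
  measure_on A mu ->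
  {ae nu, forall y, (M%:E <= potential A f mu y)%E} ->
  (M%:E <= potential A f mu y0)%E.
Proof.
move=> Ay0 c0 C0 rho0 M0 nu_le nu_ge muA aeM.
have [->|Ufin] := eqVneq (potential A f mu y0) +oo%E; first by rewrite leey.
have mA : measurable (A : set (borelType R p)) by exact: compact_measurable_rV.
have [K [dl [K0 /andP[dl0 dlrho] Kle]]] := ball_potential_le rf C0 rho0 nu_le.
have [a [del [_ del0 growth]]] := riesz_like_growth rf.
(* the factor 3 is for the balls of radius [3 * r n] below *)
pose r (n : nat) : R := Num.min dl del / 3 * n.+1%:R^-1.
have r0 n : 0 < r n by rewrite !mulr_gt0// lt_min dl0 del0.
have r3 n : 3 * r n <= Num.min dl del.
  rewrite /r mulrA mulrCA mulfV ?pnatr_eq0// mulr1 ler_piMr//.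
    by rewrite le_min !ltW.
  by rewrite invf_le1// ler1n.
have rdl n : 0 < 3 * r n <= dl.
  by rewrite mulr_gt0//= (le_trans (r3 n))// ge_min lexx.
have rr3 n : r n <= 3 * r n by rewrite ler_peMl ?(ltW (r0 n))// ler1n.
have rrho n : 0 < r n < rho.
  rewrite r0/= (le_lt_trans _ dlrho)// (le_trans (rr3 n))//.
  by case/andP: (rdl n).
have rcvg : r @ \oo --> (0 : R).
  rewrite -[X in _ --> X](mulr0 (Num.min dl del / 3)).
  by apply: cvgMl_tmp; exact: cvg_harmonic.
pose B n : set (borelType R p) := eball y0 (r n).
have mB n : measurable (B n) by exact: measurable_eball.
pose m n := fine (nu (B n)).
have mE n : nu (B n) = (m n)%:E by rewrite fineK// fin_num_measure.
have cm n : c * r n `^ d <= m n by rewrite -lee_fin -mE; exact: nu_ge.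
have m0 n : 0 < m n by rewrite (lt_le_trans _ (cm n))// mulr_gt0// powR_gt0.
pose Phi n (x : borelType R p) := ((m n)^-1%:E * \int[nu]_(y in B n) k x y)%E.
have mPhi n : measurable_fun setT (Phi n).
  by apply: emeasurable_funM => //; exact: (integral_potential (mB n)).1.
have Phi0 n x : (0 <= Phi n x)%E.
  by rewrite mule_ge0 ?integral_ge0// lee_fin invr_ge0 ltW.
have MPhi n : (M%:E <= \int[mu]_(x in A) Phi n x)%E.
  rewrite ge0_integral_conull// ge0_integralZl_EFin//; last 3 first.
  - by move=> x _; exact: integral_ge0.
  - exact: (integral_potential (mB n)).1.
  - by rewrite invr_ge0 ltW.
  rewrite (integral_potential (mB n)).2.
  have -> : M%:E = ((m n)^-1%:E * \int[nu]_(y in B n) M%:E)%E.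
    by rewrite integral_cst// [X in (_ * (_ * X))%E]mE -!EFinM mulrCA mulVf ?mulr1// gt_eqF.
  rewrite lee_wpmul2l// ?lee_fin ?invr_ge0 ?(ltW (m0 n))//.
  apply: ae_ge0_le_integral => //.
  - by move=> x _; exact: integral_ge0.
  - exact: measurable_funTS.
  - apply: negligibleS aeM => y /=; apply: contra_not => + _.
    by rewrite (potentialE rf cA).
have near_dist n x y : B n y ->
    Num.max (enorm (x - y0) - r n) 0 <= enorm (x - y) <= enorm (x - y0) + r n.
  rewrite /B /eball/= => yr; rewrite ge_max enorm_ge0 andbT; apply/andP; split.
    by rewrite lerBlDr (le_trans (enorm_triangle y x y0))// lerD2l ltW.
  by rewrite (le_trans (enorm_triangle y0 x y))// lerD2l enormBC ltW.
have Phi_between n x : (extend0 f (enorm (x - y0) + r n)%R <= Phi n x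
    <= extend0 f (Num.max (enorm (x - y0) - r n) 0)%R)%E.
  apply: (average_between (mB n) (mE n) (m0 n) (mk' x)) => //.
    by apply: (extend0_ge0 rf); rewrite addr_ge0 ?enorm_ge0 ?ltW.
  move=> y By; have /andP[h1 h2] := near_dist n x y By.
  by apply/andP; split; apply: (extend0_anti rf) => //;
    rewrite ?enorm_ge0// le_max lexx orbT.
have Phi_cvg x : Phi n x @[n --> \oo] --> k x y0.
  apply: (squeeze_cvge (nearW _ (Phi_between ^~ x))).
  - apply: (extend0_cvg_seq rf); last exact: enorm_ge0.
      by move=> n; rewrite addr_ge0 ?enorm_ge0 ?ltW.
    rewrite -[X in _ --> X]addr0; apply: cvgD => //; exact: cvg_cst.
  - apply: (extend0_cvg_seq rf); last exact: enorm_ge0.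
      by move=> n; rewrite le_max lexx orbT.
    have lcvg : enorm (x - y0) - r n @[n --> \oo] --> enorm (x - y0).
      rewrite -[X in _ --> X]subr0; apply: cvgB => //; exact: cvg_cst.
    apply: (squeeze_cvgr _ lcvg (cvg_cst (enorm (x - y0)))).
    apply: nearW => n; rewrite le_max lexx/= ge_max enorm_ge0 andbT.
    by rewrite gerBl ltW.
pose c1 := 2 `^ a + K * 3 `^ d / c.
have f0 t : 0 < t -> 0 < f t by exact: (riesz_like_gt0 rf).
have c10 : 0 < c1 by rewrite addr_gt0 ?powR_gt0// divr_gt0// mulr_gt0 ?powR_gt0.
have Phi_dom n x : A x -> (Phi n x <= c1%:E * k x y0 + (f (del / 2))%:E)%E.
  move=> Ax; have [far|close] := leP (2 * r n) (enorm (x - y0)).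
    (* the points of [B n] are at least half as far from [x] as [y0] is; beyond
       distance [del] the doubling property fails, whence the additive constant *)
    have t0 : 0 < enorm (x - y0) by rewrite (lt_le_trans _ far)// mulr_gt0.
    have t20 : 0 < enorm (x - y0) / 2 by rewrite divr_gt0.
    have /andP[_ /le_trans] := Phi_between n x; apply.
    apply: (@le_trans _ _ (extend0 f (enorm (x - y0) / 2))).
      apply: (extend0_anti rf); first exact: ltW.
      by rewrite le_max; apply/orP; left; lra.
    rewrite /k !extend0_gt0// -EFinM -EFinD lee_fin.
    have [tdel|delt] := leP (enorm (x - y0)) del.
      rewrite (@le_trans _ _ (2 `^ a * f (enorm (x - y0))))//.
        have := growth _ _ t20 (_ : _ / 2 <= enorm (x - y0)) tdel.
        rewrite invfM invrK mulrA mulfV ?gt_eqF// mul1r; apply; lra.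
      rewrite ler_wpDr ?(ltW (f0 _ _)) ?divr_gt0// ler_wpM2r ?(ltW (f0 _ _))//.
      by rewrite lerDl ltW// divr_gt0// mulr_gt0 ?powR_gt0.
    rewrite ler_wpDl ?mulr_ge0 ?(ltW (f0 _ _)) ?(ltW c10)//.
    rewrite -lee_fin -!extend0_gt0 ?divr_gt0//.
    by apply: (extend0_anti rf); [rewrite ltW ?divr_gt0|rewrite ler_pM2r ?ltW].
  (* the average over [B n] is compared with that over a ball centered at [x] *)
  have BS : B n `<=` eball x (3 * r n).
    move=> y; rewrite /B /eball/= => yr.
    rewrite (le_lt_trans (enorm_triangle y0 y x))// (enormBC y0); lra.
  have mS : measurable (eball x (3 * r n) : set (borelType R p)).
    exact: measurable_eball.
  have int_le : (\int[nu]_(y in B n) k x y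
      <= (K * (3 * r n) `^ d * f (3 * r n))%:E)%E.
    apply: le_trans (Kle x (3 * r n) Ax (rdl n)).
    apply: (@le_trans _ _ (\int[nu]_(y in eball x (3 * r n)) k x y)%E).
      by apply: ge0_subset_integral => //; exact: measurable_funTS.
    by under eq_integral do rewrite /k enormBC.
  apply: (@le_trans _ _ ((K * 3 `^ d / c) * f (3 * r n))%:E).
    apply: (@le_trans _ _ ((m n)^-1 * (K * (3 * r n) `^ d * f (3 * r n)))%:E).
      by rewrite EFinM lee_wpmul2l// lee_fin invr_ge0 ltW.
    rewrite lee_fin ler_pdivrMl// powRM ?(ltW (r0 n))//.
    apply: (@le_trans _ _ (c * r n `^ d * (K * 3 `^ d / c * f (3 * r n)))).
      rewrite le_eqVlt; apply/orP; left; apply/eqP.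
      by field; rewrite gt_eqF.
    rewrite ler_wpM2r// mulr_ge0 ?divr_ge0 ?mulr_ge0 ?powR_ge0 ?(ltW K0) ?(ltW c0)//.
    by rewrite ltW// f0; case/andP: (rdl n).
  apply: (@le_trans _ _ (c1%:E * k x y0)%E); last first.
    by rewrite leeDl// lee_fin ltW// f0// divr_gt0.
  have f3k : ((f (3 * r n))%:E <= k x y0)%E.
    rewrite -extend0_gt0; last by case/andP: (rdl n).
    by apply: (extend0_anti rf); [exact: enorm_ge0|have := r0 n; lra].
  apply: le_trans (lee_wpmul2l _ f3k); last by rewrite lee_fin ltW.
  rewrite -EFinM lee_fin ler_wpM2r//; last by rewrite lerDr powR_ge0.
  by rewrite ltW// f0; case/andP: (rdl n).
have kint : mu.-integrable A (k ^~ y0).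
  apply/integrableP; split; first exact: measurable_funTS.
  under eq_integral do rewrite gee0_abs//.
  by rewrite -/(potential A f mu y0) ltey.
have [_ _ lim] : [/\ mu.-integrable A (k ^~ y0),
    [sequence \int[mu]_(x in A) `|Phi n x - k x y0|]_n @ \oo --> 0%E &
    [sequence \int[mu]_(x in A) Phi n x]_n @ \oo -->
      (\int[mu]_(x in A) k x y0)%E]%E.
  apply: (@dominated_convergence _ _ _ mu A mA Phi (k ^~ y0)
    (fun x => c1%:E * k x y0 + (f (del / 2))%:E)%E).
  - by move=> n; exact: measurable_funTS.
  - exact: measurable_funTS.
  - by apply: aeW => x _; exact: Phi_cvg.
  - apply: integrableD => //; first exact: integrableZl.
    by apply: finite_measure_integrable_cst.
  - apply: aeW => x n Ax; rewrite gee0_abs//; exact: Phi_dom.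
by apply: (cvge_ge _ lim); apply: nearW => n; exact: MPhi.
Qed.

End AveragedPotential.

(** * The principle of domination outside of negligible sets *)

Lemma compact_enorm_bounded (R : realType) (p : nat) (A : set 'rV[R]_p) :
  compact A -> exists2 D : R, 0 < D &
    forall x y, A x -> A y -> enorm (x - y) <= D.
Proof.
move=> /compact_bounded[N [_ bN]].
pose K := Num.max N 0 + 1.
have K0 : 0 < K by rewrite ltr_wpDl// le_max lexx orbT.
have coordK x i : A x -> `|x 0 i| <= K.
  move=> Ax; have NK : N < K by rewrite (@le_lt_trans _ _ (Num.max N 0)) ?ltrDl// le_max lexx.
  apply: le_trans (bN _ NK x Ax); rewrite [leRHS]/Num.norm/= mx_normrE.
  by apply/bigmax_geP; right; exists (0, i).
exists (p.+1%:R * (K + K)); first by rewrite mulr_gt0// addr_gt0.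
move=> x y Ax Ay; apply: enorm_le_sup => [|i]; first by rewrite addr_ge0 ?ltW.
by rewrite !mxE (le_trans (ler_normB _ _))// lerD// coordK.
Qed.

(** On a bounded set the kernel is bounded below by a positive constant. *)
Lemma potential_infinite_measure (R : realType) (p : nat) (d : R)
    (A : set 'rV[R]_p) (f : R -> R)
    (mu : {measure set (borelType R p) -> \bar R}) (y : 'rV[R]_p) :
  riesz_like d f -> compact A -> A y -> mu A = +oo%E ->
  potential A f mu y = +oo%E.
Proof.
move=> rf cA Ay muoo; have [D D0 AD] := compact_enorm_bounded cA.
have fD : 0 < f D by exact: (riesz_like_gt0 rf).
have mA : measurable (A : set (borelType R p)) by exact: compact_measurable_rV.
apply/eqP; rewrite -leye_eq.
have <- : (\int[mu]_(x in A) (f D)%:E = +oo)%E.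
  by rewrite integral_cst// muoo gt0_muley// lte_fin.
apply: ge0_le_integral => //.
- by move=> x _; rewrite lee_fin ltW.
- by apply: measurable_funTS; exact: (measurable_distance_kernel0 rf).
- move=> x Ax; rewrite -extend0_gt0//.
  by apply: (extend0_anti rf); [exact: enorm_ge0|exact: AD].
Qed.

Theorem theorem2p5 (R : realType) (p : nat) (d : R) (A : set 'rV[R]_p)
    (f : R -> R) (mu : {measure set (borelType R p) -> \bar R}) (M : R)
    (E : set 'rV[R]_p) :
  d_regular d A ->
  (* A single point satisfies the definition of d-regularity vacuously. *)
  (forall a : 'rV[R]_p, A <> [set a]) ->
  riesz_like d f ->
  measure_on A mu ->
  f_negligible A f E ->
  (forall y : 'rV[R]_p, (A `\` E) y -> (M%:E <= potential A f mu y)%E) ->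
  forall y : 'rV[R]_p, A y -> (M%:E <= potential A f mu y)%E.
Proof.
move=> Areg Asingle rf muA Enegl muM y Ay.
have [cA _ _] := Areg.
have [M0|M0] := ltP M 0.
  apply: (@le_trans _ _ 0%E); first by rewrite lee_fin ltW.
  by apply: integral_ge0 => x _; exact: (distance_kernel_ge0 rf).
have mA : measurable (A : set (borelType R p)) by exact: compact_measurable_rV.
have [muoo|muoo] := eqVneq (mu A) +oo%E.
  by rewrite (potential_infinite_measure rf cA Ay muoo) leey.
have muT : (mu setT < +oo)%E.
  rewrite -(setUv A) measureU//; last 2 first.
  - exact: measurableC.
  - by rewrite setICr.
  by rewrite [X in (_ + X)%E]muA adde0 ltey.
pose mu' : {finite_measure set (borelType R p) -> \bar R} :=
  mfrestr measurableT muT.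
have mu'E S : mu' S = mu S by rewrite -[in RHS](setIT S).
have potE z : potential A f mu' z = potential A f mu z.
  by apply: eq_measure_integral => S _ _; exact: mu'E.
have mu'A : measure_on A mu' by rewrite /measure_on -muA; exact: mu'E.
have [nu [c [C [rho [nuA [c0 C0 rho0] nu_le nu_ge]]]]] :=
  d_regular_finite_measure Areg Ay (Asingle y).
have [K nuK] := upper_regular_potential_bounded rf C0 rho0 nu_le.
rewrite -potE; apply: (potential_ge_of_ae rf cA Ay c0 C0 rho0 M0 nu_le nu_ge mu'A).
apply: (ae_potential_ge rf cA mu'A nuA Enegl (K := K)) => z Az.
- by rewrite (potentialE rf cA)//; exact: nuK.
- by rewrite potE; exact: muM.
Qed.
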